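(* If the input matrix $A\in\mathbb{R}^{n\times n}$ has a constant number of nonzeros per row and per column (i.e., the number of nonzeros in each row and in each column is bounded by a constant independent of $n$), then, assuming that the number of diagonal pivoting operations per diagonal entry is bounded by a constant, the total cost of the algorithm $\mathsf{iludp\_factor}$ (described in the context) is linear in $n$.
   Context: **Notation.** $\mathrm{nnz}(\cdot)$ is the number of nonzeros of a matrix or vector. For permutation vectors $p,q$, $A[p,q]$ denotes $P^TAQ$ with $P,Q$ the corresponding permutation matrices. The factors produced are $L\in\mathbb{R}^{n\times m}$ (unit lower trapezoidal), $D\in\mathbb{R}^{m\times m}$ (diagonal), $U\in\mathbb{R}^{m\times n}$ (unit upper trapezoidal). $\ell_k$ and $u_k^T$ (of index range $k+1:n$) are the parts of column $k$ of $L$ and row $k$ of $U$ off the diagonal. The input matrix is first preprocessed (scaled by diagonal matrices and reordered by row and column permutations, which do not change the nonzero counts of rows and columns); the permutations are passed to the algorithm as initial $p,q$. The cost of preprocessing is not counted. **Algorithm $\mathsf{iludp\_factor}$** (incomplete LDU factorization with diagonal pivoting). Input: the scaled matrix $A$; permutation vectors $p,q$; the size $m$ of the current leading block; a flag sym (true if the leading $m\times m$ block is symmetric and treated by LDL$^T$); fixed constant parameters $\tau_L,\tau_U,\tau_\kappa,\tau_d>0$ and $\alpha_L,\alpha_U$ (positive integers). Constants in the linear bound may depend on these parameters, on the bound on nonzeros per row and column, and on the bound on the number of pivots per diagonal entry. Initialize $d$ to the diagonal of $A[p,q]$ (entry $d_k$ is attached to the $k$th pivot position and is permuted along with $p$),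 and let $L,U$ be empty. For $k=1,2,\dots$ while $k\le m$ ($m$ may decrease during the loop): 1. Set pivot to true iff $|1/d_k|>\tau_d$. 2. (Pivoting) If pivot is true: while $m>k$ and $|1/d_m|>\tau_d$, replace $m$ by $m-1$. If $m=k$, no candidate is left: the leading block is exhausted, set $m=k-1$ and stop. Otherwise interchange rows $k$ and $m$ of $L$, columns $k$ and $m$ of $U$, entries $k$ and $m$ of $p$, $q$ and of $d$, and replace $m$ by $m-1$. One such interchange is one diagonal pivoting operation. 3. (Crout update) Compute $\hat\ell=\frac{1}{d_k}\bigl(A[p_{k+1:n},q_k]-L_{k+1:n,1:k-1}D_{k-1}U_{1:k-1,k}\bigr)$ and $\hat u^T=\frac{1}{d_k}\bigl(A[p_k,q_{k+1:n}]-L_{k,1:k-1}D_{k-1}U_{1:k-1,k+1:n}\bigr)$, where $D_{k-1}=\mathrm{diag}(d_1,\dots,d_{k-1})$; if sym, $\hat u_{k+1:m}$ is copied from $\hat\ell_{k+1:m}$. 4. (Condition estimation) Incrementally compute $\tilde\kappa_{L,k}=|e_k^TL_k^{-1}c_{L,k}|$ and $\tilde\kappa_{U,k}=|e_k^TU_k^{-T}c_{U,k}|$, where $L_k,U_k$ are the leading $k\times k$ blocks of $L,U$ and $c_{L,k},c_{U,k}\in\{\pm1\}^k$ extend $c_{L,k-1},c_{U,k-1}$ by a sign chosen greedily to maximize these quantities (using stored partial solutions from step $k-1$). If $\max\{\tilde\kappa_{L,k},\tilde\kappa_{U,k}\}>\tau_\kappa$, set pivot to true and return to item 2 with the same $k$.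 5. For $k<i\le m$ with $\hat\ell_i\ne0$ and $\hat u_i\ne 0$, set $d_i\leftarrow d_i-d_k\hat\ell_i\hat u_i$. 6. (Thresholding) Drop $\hat\ell_i$ if $|\hat\ell_i|\tilde\kappa_{L,k}\le\tau_L$ and drop $\hat u_j$ if $|\hat u_j|\tilde\kappa_{U,k}\le\tau_U$. Then keep only the $\alpha_L\,\mathrm{nnz}(A[:,q_k])$ largest-magnitude nonzeros of $\hat\ell$ and the $\alpha_U\,\mathrm{nnz}(A[p_k,:])$ largest-magnitude nonzeros of $\hat u^T$; sort them by index and append them as column $k$ of $L$ and row $k$ of $U$. At termination, output $L$, $D=\mathrm{diag}(d_1,\dots,d_m)$, $U$, the final $p,q$, and the final $m$. **Data structures and cost model.** All storage is preallocated outside the loops. $L$ is stored in compressed column storage (arrays of row indices and values, with sorted row indices within each column) augmented by a linked list of the nonzeros in each row (column index, next nonzero in the row, position of the value in the column storage); $U$ is stored symmetrically (row storage with linked lists of columns). $A$ is likewise accessible in row and column order in constant amortized time per nonzero. For each column $j<k$ of $L$ the position of the first nonzero in $L_{k:n,j}$ is maintained, at cost $\mathcal{O}(\mathrm{nnz}(L_{k,1:k-1}))$ at step $k$ (symmetrically for $U$). $\hat\ell$ and $\hat u$ are held as dense arrays together with lists of their nonzero indices, so the thresholding in step $k$ costs $\mathcal{O}(\mathrm{nnz}(\hat\ell))$ and sorting the kept entries costs $\mathcal{O}(\mathrm{nnz}(\ell_k)\log\mathrm{nnz}(\ell_k))$ (analogously for $U$). A row interchange of rows $k<i$ in $L$ re-sorts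 the entries of $L_{k:i,j}$ at cost $\mathcal{O}(\mathrm{nnz}(L_{k:i,j}))$ for each column $j$ in which row $k$ or row $i$ has a nonzero, and updates the row lists in time linear in the number of nonzeros of the two rows (analogously for columns of $U$). Total cost counts floating-point operations, index operations, comparisons and data movement. *)

(* Defs.v *)
(* MathComp, with the reals abstracted as [R : realType]. *)
From mathcomp Require Import all_boot all_order all_fingroup all_algebra.
From mathcomp Require Import reals zify lra.

Set Implicit Arguments.
Unset Strict Implicit.
Unset Printing Implicit Defensive.

Import Order.TTheory GRing.Theory Num.Theory.
Local Open Scope ring_scope.

Definition nnz (R : nmodType) (m n : nat) (M : 'M[R]_(m, n)) : nat :=
  #|[set ij : 'I_m * 'I_n | M ij.1 ij.2 != 0]|.

(* A value together with the cost of computing it. *)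
Definition timed (T : Type) : Type := (T * nat)%type.

Definition value {T : Type} (x : timed T) : T := x.1.
Definition cost {T : Type} (x : timed T) : nat := x.2.

Definition ret {T : Type} (x : T) : timed T := (x, 0%N).

Definition bind {T S : Type} (x : timed T) (f : T -> timed S) : timed S :=
  (value (f (value x)), (cost x + cost (f (value x)))%N).

Definition tick (c : nat) : timed unit := (tt, c).

Notation "'let*' x := e 'in' f" := (bind e (fun x => f))
  (at level 200, x binder, e at level 200, f at level 200, right associativity).
Notation "e ;; f" := (bind e (fun _ => f))
  (at level 199, right associativity).

Fixpoint foreach {I S : Type} (s : seq I) (x : S) (body : I -> S -> timed S) :
    timed S :=
  if s is i :: s' then let* y := body i x in foreach s' y body else ret x.

(* The constants hidden in the O(.) bounds of the primitive operations. *)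
Record weights := Weights {
  w_op : nat;    (* a constant-size group of flops, comparisons, index
                    operations and moves, including one step along a list *)
  w_acc : nat;   (* access to one nonzero of A, by row or by column *)
  w_first : nat; (* maintaining the first-nonzero positions, per nonzero *)
  w_thr : nat;   (* thresholding, per nonzero of the vector *)
  w_sort : nat;  (* sorting s indices, per unit of s log s *)
  w_swap : nat   (* interchanging two rows, per nonzero involved *)
}.

Record params (R : realType) := Params {
  tau_L : R;
  tau_U : R;
  tau_kappa : R;
  tau_d : R;
  alpha_L : nat;
  alpha_U : nat
}.

Definition valid_params (R : realType) (P : params R) : Prop :=
  [/\ 0 < tau_L P, 0 < tau_U P, 0 < tau_kappa P & 0 < tau_d P] /\
  (0 < alpha_L P)%N /\ (0 < alpha_U P)%N.

(* Index lists of the nonzeros in a column, a row, a vector. They stand for the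
   compressed columns (with sorted indices) and for the linked lists of rows;
   walking along one of them is charged per element by the code below. *)
Definition nzcol (R : nmodType) (n : nat) (M : 'M[R]_n) (j : 'I_n) : seq 'I_n :=
  [seq i <- enum 'I_n | M i j != 0].
Definition nzrow (R : nmodType) (n : nat) (M : 'M[R]_n) (i : 'I_n) : seq 'I_n :=
  [seq j <- enum 'I_n | M i j != 0].
Definition nzvec (R : nmodType) (n : nat) (v : 'cV[R]_n) : seq 'I_n :=
  [seq i <- enum 'I_n | v i 0 != 0].

Definition setv (R : nmodType) (n : nat) (v : 'cV[R]_n) (i : 'I_n) (x : R) :
    'cV[R]_n :=
  \col_l (if l == i then x else v l 0).

(* Indices are 0-based: position k : 'I_n below is pivot position k + 1 of the
   usual 1-based description, and the leading block of size m consists of the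
   positions i < m.

   A[p, q] has entries A (p i) (q j).

   L and U are stored as square matrices in which only the columns (rows) of
   the finished steps are filled, unit diagonal included; all other entries
   are 0.  The routines working on L serve for U as well, applied to
   transposed data and with p and q exchanged. *)
Record state (R : realType) (n : nat) := State {
  st_p : 'S_n;
  st_q : 'S_n;
  st_m : nat;
  st_d : 'rV[R]_n;
  st_L : 'M[R]_n;
  st_U : 'M[R]_n;
  st_yL : 'rV[R]_n; (* leading part: the partial solution L_k^-1 c_(L,k) *)
  st_yU : 'rV[R]_n; (* leading part: the partial solution U_k^-T c_(U,k) *)
  st_piv : seq 'I_n (* log, not charged: the step k of every interchange *)
}.

Section Routines.
Variables (R : realType) (n : nat) (W : weights).
Implicit Types (A L U : 'M[R]_n) (p q : 'S_n) (d y : 'rV[R]_n) (k : 'I_n).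

(* The division by d_k is last; [keep] selects the wanted positions. *)
Definition crout A p q L U d k (keep : pred 'I_n) : timed 'cV[R]_n :=
  let* w := foreach (nzcol A (q k)) 0 (fun i w =>
              tick (w_acc W) ;;
              let l := (p^-1)%g i in
              ret (if keep l then setv w l (A i (q k)) else w)) in
  let* w := foreach [seq j : 'I_n <- nzcol U k | (j < k)%N] w (fun j w =>
              tick (w_op W) ;;
              foreach [seq i : 'I_n <- nzcol L j | (k < i)%N] w (fun i w =>
                tick (w_op W) ;;
                ret (if keep i
                     then setv w i (w i 0 - L i j * d 0 j * U j k) else w))) in
  foreach (nzvec w) w (fun i w =>
    tick (w_op W) ;;
    ret (setv w i (w i 0 / d 0 k))).

(* Row k of the forward substitution for L_k y = c, with the sign c_k that
   makes |y_k| = |c_k - s| largest (c_k = 1 if both signs are equally good). *)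
Definition estimate L y k : timed R :=
  let* s := foreach [seq j : 'I_n <- nzrow L k | (j < k)%N] 0 (fun j s =>
              tick (w_op W) ;;
              ret (s + L k j * y 0 j)) in
  tick (w_op W) ;;
  ret ((if s <= 0 then 1 else -1) - s).

(* Ties between entries of equal magnitude go to the smaller index. *)
Definition threshold (tau kappa : R) (t : nat) (w : 'cV[R]_n) :
    timed 'cV[R]_n :=
  let large := [seq i <- nzvec w | tau < `|w i 0| * kappa] in
  let kept := take t (sort (fun i j => `|w j 0| <= `|w i 0|) large) in
  tick (w_thr W * (size (nzvec w)).+1) ;;
  tick (w_sort W * (size kept * up_log 2 (size kept)).+1) ;;
  ret (\col_i (if i \in kept then w i 0 else 0)).

Definition append L k (l : 'cV[R]_n) : timed 'M[R]_n :=
  tick (w_op W * (size (nzvec l)).+1) ;;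
  ret (\matrix_(i, j) (if j == k then if i == k then 1 else l i 0 else L i j)).

Definition advance L k : timed unit :=
  tick (w_first W * (size [seq j : 'I_n <- nzrow L k | (j < k)%N]).+1).

Definition clear (w : 'cV[R]_n) : timed unit :=
  tick (w_op W * (size (nzvec w)).+1).

(* Rows k < i of L: the entries between positions k and i are re-sorted in every
   column that meets one of the two rows, and the two row lists are updated. *)
Definition interchange_rows L k (i : 'I_n) : timed 'M[R]_n :=
  foreach [seq j <- enum 'I_n | (L k j != 0) || (L i j != 0)] tt (fun j _ =>
    tick (w_swap W * (size [seq l : 'I_n <- nzcol L j | (k <= l <= i)%N]).+1)) ;;
  tick (w_swap W * (size (nzrow L k) + size (nzrow L i)).+1) ;;
  ret (xrow k i L).

End Routines.

Section Iludp.
Variables (R : realType) (P : params R) (W : weights) (n' : nat).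
Let n := n'.+1.
Variables (A : 'M[R]_n) (sym : bool).
Implicit Types (st : state R n) (k : nat).

(* |1/d| > tau_d, where |1/0| is infinite (whereas 0^-1 = 0 in the library). *)
Definition bad_pivot (d : R) : bool := (d == 0) || (tau_d P < `|1 / d|).

(* The loop [while m > k and |1/d_m| > tau_d, replace m by m - 1]. *)
Fixpoint shrink (d : 'rV[R]_n) k (m : nat) : timed nat :=
  tick (w_op W) ;;
  if m is m'.+1 then
    if (k.+1 < m)%N && bad_pivot (d 0 (inord m')) then shrink d k m' else ret m
  else ret m.

(* The result [None] means that no candidate is left. *)
Definition pivoting st k : timed (option (state R n)) :=
  let: State p q m d L U yL yU piv := st in
  let* m := shrink d k m in
  if (m <= k.+1)%N then ret None else
  let kk : 'I_n := inord k in
  let mm : 'I_n := inord m.-1 in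
  let* L := interchange_rows W L kk mm in
  let* Ut := interchange_rows W U^T kk mm in
  tick (w_op W) ;;
  ret (Some (State (tperm kk mm * p)%g (tperm kk mm * q)%g m.-1
              (xcol kk mm d) L Ut^T yL yU (kk :: piv))).

(* Crout update, condition estimation, update of d and thresholding for step k;
   [None] means that the condition estimate is too large, in which case nothing
   is stored. *)
Definition elimination st k : timed (option (state R n)) :=
  let: State p q m d L U yL yU piv := st in
  let kk : 'I_n := inord k in
  let* l := crout W A p q L U d kk (fun i => (k < i)%N) in
  let* u := crout W A^T q p U^T L^T d kk
              (fun i => (k < i)%N && ~~ (sym && (i < m)%N)) in
  let* u := if sym then
              foreach (nzvec l) u (fun i u =>
                tick (w_op W) ;;
                ret (if (i < m)%N then setv u i (l i 0) else u))
            else ret u in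
  let* eL := estimate W L yL kk in
  let* eU := estimate W U^T yU kk in
  tick (w_op W) ;;
  if tau_kappa P < Num.max `|eL| `|eU| then
    clear W l ;; clear W u ;; ret None
  else
    let* d := foreach (nzvec l) d (fun i d =>
                tick (w_op W) ;;
                ret (if (i < m)%N && (u i 0 != 0)
                     then \row_j (if j == i
                                  then d 0 i - d 0 kk * l i 0 * u i 0
                                  else d 0 j)
                     else d)) in
    let* lk := threshold W (tau_L P) `|eL| (alpha_L P * nnz (col (q kk) A)) l in
    let* uk := threshold W (tau_U P) `|eU| (alpha_U P * nnz (row (p kk) A)) u in
    clear W l ;; clear W u ;;
    let* L := append W L kk lk in
    let* Ut := append W U^T kk uk in
    advance W L kk ;; advance W Ut kk ;;
    tick (w_op W) ;;
    ret (Some (State p q m d L Ut^T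
                (\row_j (if j == kk then eL else yL 0 j))
                (\row_j (if j == kk then eU else yU 0 j)) piv)).

Definition with_m st (m : nat) : state R n :=
  let: State p q _ d L U yL yU piv := st in State p q m d L U yL yU piv.

(* [retry] is true when step k is resumed with a forced pivoting after a failed
   condition estimate; [fuel] only bounds the recursion, see [iludp_loop_fuel]. *)
Fixpoint iludp_loop (fuel : nat) (retry : bool) k st : timed (state R n) :=
  if fuel isn't fuel'.+1 then ret st else
  tick (w_op W) ;;
  if (st_m st <= k)%N then ret st else
  let* r := if retry || bad_pivot (st_d st 0 (inord k)) then pivoting st k
            else ret (Some st) in
  if r isn't Some st1 then ret (with_m st k) else
  let* r := elimination st1 k in
  if r is Some st2 then iludp_loop fuel' false k.+1 st2
  else iludp_loop fuel' true k st1.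

(* Preallocation of the dense arrays and of the maximal storage for L and U,
   then extraction of the diagonal of A[p, q] by searching the rows of A. *)
Definition initialize (p q : 'S_n) (m : nat) : timed (state R n) :=
  tick (w_op W * (n + alpha_L P * nnz A + alpha_U P * nnz A)) ;;
  let* d := foreach (enum 'I_n) (0 : 'rV[R]_n) (fun i d =>
              tick (w_op W) ;;
              foreach (nzrow A (p i)) d (fun j d =>
                tick (w_acc W) ;;
                ret (if j == q i
                     then \row_l (if l == i then A (p i) j else d 0 l)
                     else d))) in
  ret (State p q m d 0 0 0 0 [::]).

Definition iludp_factor (p q : 'S_n) (m : nat) : timed (state R n) :=
  let* st := initialize p q m in iludp_loop m.+2 false 0 st.

End Iludp.

Lemma foreach_cons (I S : Type) (i : I) (s : seq I) (x : S)
    (body : I -> S -> timed S) :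
  value (foreach (i :: s) x body) = value (foreach s (value (body i x)) body).
Proof. by []. Qed.

Lemma value_bind (T S : Type) (x : timed T) (f : T -> timed S) :
  value (bind x f) = value (f (value x)).
Proof. by []. Qed.

Lemma crout_gather (R : realType) (n : nat) (W : weights) (A : 'M[R]_n)
    (p : 'S_n) (c : 'I_n) (keep : pred 'I_n) (s : seq 'I_n) (w : 'cV[R]_n)
    (l : 'I_n) :
  value (foreach s w (fun i w =>
    tick (w_acc W) ;;
    let l := (p^-1)%g i in
    ret (if keep l then setv w l (A i c) else w))) l 0 =
  if keep l && (p l \in s) then A (p l) c else w l 0.
Proof.
elim: s w => [|i s IH] w; first by rewrite andbF.
rewrite foreach_cons IH inE /value /=.
have -> : (p l == i) = (l == (p^-1)%g i).
  by rewrite -(inj_eq (@perm_inj _ p) l) permKV.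
case: (eqVneq l ((p^-1)%g i)) => [->|ne] /=.
  rewrite permKV andbT; case: (keep _) => //=.
  by rewrite mxE eqxx; case: (i \in s).
by case: ifP => //; case: (keep ((p^-1)%g i)); rewrite ?mxE ?(negbTE ne).
Qed.

Lemma crout_axpy (R : realType) (n : nat) (W : weights) (x : 'I_n -> R)
    (keep : pred 'I_n) (s : seq 'I_n) (w : 'cV[R]_n) (l : 'I_n) :
  uniq s ->
  value (foreach s w (fun i w =>
    tick (w_op W) ;;
    ret (if keep i then setv w i (w i 0 - x i) else w))) l 0 =
  if keep l && (l \in s) then w l 0 - x l else w l 0.
Proof.
elim: s w => [|i s IH] w; first by rewrite andbF.
rewrite cons_uniq => /andP[nis us]; rewrite foreach_cons IH // inE /value /=.
case: (eqVneq l i) => [->|ne] /=.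
  by rewrite (negbTE nis) !andbF andbT; case: ifP; rewrite ?mxE ?eqxx.
by case: (keep i); rewrite ?mxE ?(negbTE ne).
Qed.

Lemma crout_scale (R : realType) (n : nat) (W : weights) (a : R)
    (s : seq 'I_n) (w : 'cV[R]_n) (l : 'I_n) :
  uniq s ->
  value (foreach s w (fun i w =>
    tick (w_op W) ;; ret (setv w i (w i 0 / a)))) l 0 =
  if l \in s then w l 0 / a else w l 0.
Proof.
elim: s w => [|i s IH] w //.
rewrite cons_uniq => /andP[nis us]; rewrite foreach_cons IH // inE /value /= mxE.
by case: (eqVneq l i) => [->|ne] //=; rewrite (negbTE nis).
Qed.

Lemma croutE (R : realType) (n : nat) (W : weights) (A : 'M[R]_n) (p q : 'S_n)
    (L U : 'M[R]_n) (d : 'rV[R]_n) (k : 'I_n) (keep : pred 'I_n) :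
  (forall i, keep i -> (k < i)%N) ->
  value (crout W A p q L U d k keep) =
  \col_i (if keep i
          then (A (p i) (q k) - \sum_(j < n | (j < k)%N) L i j * d 0 j * U j k)
               / d 0 k
          else 0).
Proof.
move=> keepP; apply/colP => l; rewrite mxE /crout !value_bind.
set w1 := value (foreach _ 0 _).
set w2 := value (foreach _ w1 _).
have w2E : w2 l 0 = if keep l
    then A (p l) (q k) - \sum_(j < n | (j < k)%N) L l j * d 0 j * U j k else 0.
  have w1E : w1 l 0 = if keep l then A (p l) (q k) else 0.
    rewrite /w1 crout_gather mxE mem_filter mem_enum andbT.
    by case: (keep l) => //=; case: eqVneq => [->|].
  have -> : w2 l 0 = w1 l 0 - \sum_(j <- [seq j : 'I_n <- nzcol U k | (j < k)%N])
      (if keep l then L l j * d 0 j * U j k else 0).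
    rewrite /w2; move: w1 [seq j <- _ | _] {w1E w2} => w js.
    elim: js w => [|j js IH] w; first by rewrite big_nil subr0.
    rewrite foreach_cons IH big_cons opprD addrA; congr (_ - _).
    rewrite {1}/value /= -/(value _).
    rewrite (crout_axpy W (fun i => L i j * d 0 j * U j k)); last first.
      by do 2!apply: filter_uniq; apply: enum_uniq.
    rewrite 2!mem_filter mem_enum andbT.
    case: (boolP (keep l)) => [kl|_] /=; last by rewrite subr0.
    by rewrite keepP //=; case: eqVneq => [->|//]; rewrite !mul0r subr0.
  rewrite w1E; case: (keep l); last first.
    by rewrite big1_eq subr0.
  congr (_ - _); rewrite big_filter big_filter_cond big_enum_cond /=.
  rewrite big_mkcond [RHS]big_mkcond /=; apply: eq_bigr => j _.
  by case: (j < k)%N; case: eqVneq => // ->; rewrite ?mulr0.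
rewrite crout_scale; last by apply: filter_uniq; apply: enum_uniq.
rewrite mem_filter mem_enum andbT w2E; case: (keep l); last by rewrite eqxx.
by case: eqVneq => [->|//]; rewrite mul0r.
Qed.

Lemma estimateE (R : realType) (n : nat) (W : weights) (L : 'M[R]_n)
    (y : 'rV[R]_n) (k : 'I_n) :
  let s := \sum_(j < n | (j < k)%N) L k j * y 0 j in
  exists2 c : R, c = 1 \/ c = -1 &
    value (estimate W L y k) = c - s /\
    forall c' : R, c' = 1 \/ c' = -1 -> `|c' - s| <= `|c - s|.
Proof.
move=> s; rewrite /estimate value_bind.
have -> : value (foreach [seq j : 'I_n <- nzrow L k | (j < k)%N] 0 (fun j s =>
    tick (w_op W) ;; ret (s + L k j * y 0 j))) = s.
  have foldE js (x : R) : value (foreach js x (fun j s =>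
      tick (w_op W) ;; ret (s + L k j * y 0 j))) =
      x + \sum_(j <- js) L k j * y 0 j.
    elim: js x => [|j js IH] x; first by rewrite big_nil addr0.
    by rewrite foreach_cons IH big_cons addrA.
  rewrite foldE add0r /s big_filter big_filter_cond big_enum_cond /=.
  rewrite big_mkcond [RHS]big_mkcond /=; apply: eq_bigr => j _.
  by case: (j < k)%N; rewrite ?andbF // andbT; case: eqVneq => // ->; rewrite mul0r.
rewrite !value_bind; exists (if s <= 0 then 1 else -1).
  by case: ifP; [left|right].
split=> // c' c'E; clearbody s; case: (leP s 0) => s0.
  have n1 : `|1 - s| = 1 - s by rewrite ger0_norm //; lra.
  by rewrite n1 ler_norml; case: c'E => ->; apply/andP; split; lra.
have n1 : `|-1 - s| = 1 + s by rewrite ler0_norm ?opprB ?opprD; lra.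
by rewrite n1 ler_norml; case: c'E => ->; apply/andP; split; lra.
Qed.

Lemma shrink_le (R : realType) (P : params R) (W : weights) (n' : nat)
    (d : 'rV[R]_n'.+1) (k m : nat) :
  (value (shrink P W d k m) <= m)%N.
Proof.
elim: m => [|m IH] //=; case: ifP => _ //.
by apply: leq_trans (leqnSn m).
Qed.

Lemma pivoting_m (R : realType) (P : params R) (W : weights) (n' : nat)
    (st st1 : state R n'.+1) (k : nat) :
  value (pivoting P W st k) = Some st1 -> (k < st_m st1 < st_m st)%N.
Proof.
case: st => p q m d L U yL yU piv; rewrite /pivoting {1}/value /= -!/(value _).
have := shrink_le P W d k m; case: (value _) => [|m1] // m1m.
case: ifP => [//|]; rewrite /value /= ltnS => /negbT; rewrite -ltnNge => km [<-] /=.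
by rewrite km.
Qed.

Lemma elimination_m (R : realType) (P : params R) (W : weights) (n' : nat)
    (A : 'M[R]_n'.+1) (sym : bool) (st st1 : state R n'.+1) (k : nat) :
  value (elimination P W A sym st k) = Some st1 -> st_m st1 = st_m st.
Proof.
case: st => p q m d L U yL yU piv; rewrite /elimination {1}/value /= -!/(value _).
by case: ifP => _ //; rewrite /value /= => -[<-].
Qed.

Lemma iludp_loop_fuel (R : realType) (P : params R) (W : weights) (n' : nat)
    (A : 'M[R]_n'.+1) (sym : bool) (st : state R n'.+1) (k : nat) (retry : bool)
    (fuel extra : nat) :
  (st_m st - k + ~~ retry < fuel)%N ->
  iludp_loop P W A sym (fuel + extra) retry k st =
  iludp_loop P W A sym fuel retry k st.
Proof.
elim: fuel st k retry => [|fuel IH] st k retry //; rewrite ltnS => le_fuel.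
rewrite addSn /= /bind; case: leqP => [//|km].
set piv := if _ || _ then _ else _.
case E1: (value piv) => [st1|] //.
have m1 : (k < st_m st1)%N /\ (st_m st1 + retry <= st_m st)%N.
  move: E1; rewrite {}/piv; case: (boolP (retry || _)) => [_ /pivoting_m/andP[-> lt]|].
    by split=> //; case: retry {le_fuel}; rewrite ?addn1 ?addn0 // ltnW.
  by rewrite negb_or => /andP[/negbTE-> _] [<-]; rewrite addn0.
case: m1 => km1 m1.
have lt1 : (st_m st1 - k < fuel)%N.
  by move: le_fuel; case: (retry) m1 => /=; lia.
case E2: (value (elimination _ _ _ _ _ _)) => [st2|]; rewrite IH //=.
  by rewrite (elimination_m E2) addn1 -subSn.
by rewrite addn0.
Qed.

(* Main.v *)
(** The cost is amortized over the entries of L and U.  An interchange at step k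
    moves the rejected row of L beyond the new leading block, where it is never
    touched again.  Hence each row is interchanged at most twice (brought to
    position k, rejected) and used at most once by an elimination attempt, so
    that the sum of the nonzero counts of all visited rows is O(nnz L); the same
    holds for the columns of U.  Since dropping leaves O(1) entries in every
    column of L and row of U, each visited entry costs O(1), and
    nnz L + nnz U = O(n).  This is a potential argument: a row has weight 3 while
    it waits in the leading block, 2 when it is at position k, 1 after a failed
    condition estimate and 0 once it is eliminated or rejected. *)
Require Import Defs.
From mathcomp Require Import all_boot all_order all_fingroup all_algebra.
From mathcomp Require Import reals.
From mathcomp Require Import zify.

Set Implicit Arguments.
Unset Strict Implicit.
Unset Printing Implicit Defensive.

Import Order.TTheory GRing.Theory Num.Theory.
Local Open Scope ring_scope.

(** * Costs and values of timed loops *)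

Lemma cost_bind (T S : Type) (x : timed T) (f : T -> timed S) :
  cost (bind x f) = (cost x + cost (f (value x)))%N.
Proof. by []. Qed.

Lemma cost_tick (a : nat) : cost (tick a) = a. Proof. by []. Qed.

Lemma cost_ret (T : Type) (x : T) : cost (ret x) = 0%N. Proof. by []. Qed.

Lemma value_ret (T : Type) (x : T) : value (ret x) = x. Proof. by []. Qed.

Definition costE := (cost_bind, cost_tick, cost_ret).

Lemma cost_foreach (I S : Type) (a : nat) (s : seq I) (x : S)
    (body : I -> S -> timed S) :
  (forall i y, cost (body i y) <= a)%N ->
  (cost (foreach s x body) <= a * size s)%N.
Proof.
move=> body_a; elim: s x => [|i s IH] x //.
rewrite mulnS; apply: leq_trans (leq_add (body_a i x) (IH _)).
exact: leqnn.
Qed.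

(** Serves with [f] the number of nonzeros of a dense vector, to bound the fill that a loop of
    assignments creates. *)
Lemma value_foreach_le (I S : Type) (f : S -> nat) (a : nat) (s : seq I) (x : S)
    (body : I -> S -> timed S) :
  (forall i y, f (value (body i y)) <= f y + a)%N ->
  (f (value (foreach s x body)) <= f x + a * size s)%N.
Proof.
move=> body_a; elim: s x => [|i s IH] x; first by rewrite /= muln0 addn0.
rewrite foreach_cons /= mulnS addnA; apply: leq_trans (IH _) _.
by rewrite leq_add2r.
Qed.

(** * Nonzero counts as sums of indicators *)

Lemma size_filter_ord (n : nat) (P : pred 'I_n) :
  size [seq i <- enum 'I_n | P i] = (\sum_(i < n) P i)%N.
Proof.
by rewrite size_filter -sum1_count big_enum_cond big_mkcond; apply: eq_bigr => i _;
   case: (P i).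
Qed.

Lemma size_filter_le (T : Type) (a : pred T) (s : seq T) :
  (size [seq x <- s | a x] <= size s)%N.
Proof. by rewrite size_filter count_size. Qed.

Lemma sum_ord_pred1 (n : nat) (k : 'I_n) : (\sum_(i < n) (i == k))%N = 1%N.
Proof. by rewrite (bigD1 k) //= eqxx big1 // => i /negbTE ->. Qed.

Lemma nnzE (R : nmodType) (m n : nat) (M : 'M[R]_(m, n)) :
  nnz M = (\sum_(i < m) \sum_(j < n) (M i j != 0%R))%N.
Proof.
rewrite /nnz cardsE -sum1_card big_mkcond pair_big /=.
by apply: eq_bigr => -[i j] _; rewrite unfold_in /=; case: (_ != _).
Qed.

Lemma nnz_row (R : nmodType) (n : nat) (M : 'M[R]_n) (i : 'I_n) :
  nnz (row i M) = size (nzrow M i).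
Proof.
by rewrite nnzE big_ord1 size_filter_ord; apply: eq_bigr => j _; rewrite mxE.
Qed.

Lemma nnz_col (R : nmodType) (n : nat) (M : 'M[R]_n) (j : 'I_n) :
  nnz (col j M) = size (nzcol M j).
Proof.
by rewrite nnzE size_filter_ord; apply: eq_bigr => i _; rewrite big_ord1 mxE.
Qed.

Lemma nzcol_tr (R : nmodType) (n : nat) (M : 'M[R]_n) (j : 'I_n) :
  nzcol M^T j = nzrow M j.
Proof. by apply: eq_filter => i; rewrite mxE. Qed.

Lemma size_nzvec_setv (R : nmodType) (n : nat) (v : 'cV[R]_n) (i : 'I_n) (x : R) :
  (size (nzvec (setv v i x)) <= size (nzvec v) + 1)%N.
Proof.
rewrite !size_filter_ord -[X in (_ <= _ + X)%N](sum_ord_pred1 i) -big_split.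
apply: leq_sum => l _ /=.
by rewrite mxE; case: (l == i); rewrite ?addn0 //;
   exact: leq_trans (leq_b1 _) (leq_addl _ _).
Qed.

Lemma size_nzcol_xrow (R : nmodType) (n : nat) (M : 'M[R]_n) (i1 i2 j : 'I_n) :
  size (nzcol (xrow i1 i2 M) j) = size (nzcol M j).
Proof.
rewrite !size_filter_ord (reindex_inj (@perm_inj _ (tperm i1 i2))) /=.
by apply: eq_bigr => i _; rewrite mxE tpermK.
Qed.

Lemma size_nzrow_xrow (R : nmodType) (n : nat) (M : 'M[R]_n) (i1 i2 i : 'I_n) :
  size (nzrow (xrow i1 i2 M) i) = size (nzrow M (tperm i1 i2 i)).
Proof. by rewrite !size_filter_ord; apply: eq_bigr => j _; rewrite mxE. Qed.

(** * Cost and fill of the single routines *)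

Section RoutineCosts.
Variables (R : realType) (n : nat) (W : weights).

(** A nonzero of the result stems from the column of [A], with at most [c] entries, or from one of
    the columns of [L] selected by the nonzeros of column [k] of [U], with at most [K] entries each.
    So cost and fill are affine in [size (nzcol U k)]. *)
Lemma crout_bounds (A : 'M[R]_n) (p q : 'S_n) (L U : 'M[R]_n) (d : 'rV[R]_n)
    (k : 'I_n) (keep : pred 'I_n) (c K : nat) :
  (size (nzcol A (q k)) <= c)%N -> (forall j, size (nzcol L j) <= K)%N ->
  let w := crout W A p q L U d k keep in
  (size (nzvec (value w)) <= 2 * c + 2 * K * size (nzcol U k))%N /\
  (cost w <= (w_acc W + w_op W) * c
             + (w_op W * (1 + K + K)) * size (nzcol U k))%N.
Proof.
move=> Ac LK w; rewrite {}/w /crout !costE !value_bind.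
set w1 := foreach (nzcol A _) _ _.
have w1c : (size (nzvec (value w1)) <= c)%N.
  have := @value_foreach_le _ _ (fun v : 'cV[R]_n => size (nzvec v)) 1%N
    (nzcol A (q k)) 0 (fun i w => tick (w_acc W) ;;
     ret (if keep ((p^-1)%g i) then setv w ((p^-1)%g i) (A i (q k)) else w)).
  rewrite -/w1 mul1n => /(_ _)/leq_trans; apply.
    by move=> i y; rewrite value_bind /=; case: ifP => _;
       rewrite ?size_nzvec_setv // leq_addr.
  by rewrite size_filter_ord big1 ?add0n // => i _; rewrite mxE eqxx.
have w1C : (cost w1 <= w_acc W * c)%N.
  apply: leq_trans (cost_foreach (a := w_acc W) _ _ _) _.
    by move=> i y; rewrite !costE addn0.
  by rewrite leq_mul2l Ac orbT.
set w2 := foreach _ (value w1) _.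
set s := [seq _ <- nzcol U k | _] in w2 *.
have ss : (size s <= size (nzcol U k))%N by exact: size_filter_le.
have w2c : (size (nzvec (value w2)) <= c + K * size s)%N.
  apply: leq_trans (_ : _ <= size (nzvec (value w1)) + K * size s)%N _; last first.
    by rewrite leq_add2r.
  apply: (value_foreach_le (f := fun v : 'cV[R]_n => size (nzvec v))) => j y.
  rewrite value_bind.
  apply: leq_trans (value_foreach_le (f := fun v : 'cV[R]_n => size (nzvec v))
    (a := 1%N) _ _ _) _; last first.
    by rewrite leq_add2l mul1n (leq_trans _ (LK j)) ?size_filter_le.
  by move=> i z; rewrite value_bind /=; case: ifP => _;
     rewrite ?size_nzvec_setv // leq_addr.
have w2C : (cost w2 <= (w_op W + w_op W * K) * size s)%N.
  apply: cost_foreach => j y; rewrite !costE leq_add2l.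
  apply: leq_trans (cost_foreach (a := w_op W) _ _ _) _.
    by move=> i z; rewrite !costE addn0.
  by rewrite leq_mul2l (leq_trans _ (LK j)) ?orbT // size_filter_le.
set w3 := foreach _ (value w2) _.
have w3C : (cost w3 <= w_op W * size (nzvec (value w2)))%N.
  by apply: cost_foreach => i y; rewrite !costE addn0.
(* One possible new nonzero is counted per assignment although division creates none; this crude
   count gives the factor 2 in the fill bound. *)
have w3c : (size (nzvec (value w3)) <=
            size (nzvec (value w2)) + 1 * size (nzvec (value w2)))%N.
  apply: (value_foreach_le (f := fun v : 'cV[R]_n => size (nzvec v))) => i y.
  exact: size_nzvec_setv.
move: w1C w2c w2C w3c w3C; rewrite mul1n.
move: (size (nzvec (value w2))) (size (nzvec (value w3))) => y z.
move: (size s) (size (nzcol U k)) ss => S N SN x1 y2 x2 y3 x3.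
have KS : (K * S <= K * N)%N by rewrite leq_mul2l SN orbT.
split; first by move: KS y2 y3; lia.
have opS : (w_op W * (S + 2 * (K * S)) <= w_op W * (N + 2 * (K * N)))%N.
  by rewrite leq_mul2l leq_add ?orbT // leq_mul2l KS.
have := leq_trans x3 (leq_mul (leqnn (w_op W)) y2).
by move: x1 x2 opS; move: (cost w1) (cost w2) (cost w3) => C1 C2 C3; lia.
Qed.

Lemma cost_estimate (L : 'M[R]_n) (y : 'rV[R]_n) (k : 'I_n) :
  (cost (estimate W L y k) <= w_op W * (size (nzrow L k)).+1)%N.
Proof.
rewrite /estimate !costE addn0 mulnS addnC leq_add2l.
apply: leq_trans (cost_foreach (a := w_op W) _ _ _) _.
  by move=> j s; rewrite !costE addn0.
by rewrite leq_mul2l size_filter_le orbT.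
Qed.

(** The cut by [take] bounds the surviving entries by [t], whatever the fill of [w]; this keeps the
    columns of [L] and the rows of [U] short. *)
Lemma threshold_bounds (tau kappa : R) (t : nat) (w : 'cV[R]_n) :
  let v := threshold W tau kappa t w in
  (size (nzvec (value v)) <= t)%N /\
  (cost v <= w_thr W * (size (nzvec w)).+1 + w_sort W * (t * up_log 2 t).+1)%N.
Proof.
move=> v; rewrite {}/v /threshold !costE !value_bind value_ret.
set kept := take t _.
have st : (size kept <= t)%N by rewrite size_take_min geq_minl.
split; last first.
  by rewrite addn0 leq_add2l leq_mul2l ltnS leq_mul ?orbT // leq_up_log.
apply: leq_trans st; apply: leq_trans (card_size kept).
rewrite size_filter_ord -sum1_card [leqRHS]big_mkcond; apply: leq_sum => i _ /=.
by rewrite mxE; case: ifP; rewrite ?eqxx //; case: (_ != _).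
Qed.

Lemma size_nzcol_append (L : 'M[R]_n) (k j : 'I_n) (l : 'cV[R]_n) :
  (size (nzcol (value (append W L k l)) j) <=
   if j == k then (size (nzvec l)).+1 else size (nzcol L j))%N.
Proof.
rewrite /append value_bind value_ret; case: eqVneq => [->|/negbTE jk].
  rewrite !size_filter_ord -[leqRHS]addn1.
  rewrite -[X in (_ <= _ + X)%N](sum_ord_pred1 k) -big_split.
  apply: leq_sum => i _ /=.
  by rewrite mxE eqxx; case: (i == k); rewrite ?addn0 //;
     exact: leq_trans (leq_b1 _) (leq_addl _ _).
by rewrite !size_filter_ord; apply: leq_sum => i _; rewrite mxE jk.
Qed.

Lemma size_nzrow_append (L : 'M[R]_n) (k i : 'I_n) (l : 'cV[R]_n) :
  (size (nzrow (value (append W L k l)) i) <=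
   size (nzrow L i) + ((l i 0%R != 0%R) || (i == k)))%N.
Proof.
rewrite /append value_bind value_ret !size_filter_ord.
rewrite -[X in (_ <= _ + X)%N]muln1
  -[X in (_ <= _ + _ * X)%N](sum_ord_pred1 k) big_distrr -big_split.
apply: leq_sum => j _ /=; rewrite mxE; case: (j == k); last exact: leq_addr.
by case: (i == k); case: (l i 0 != 0) => //;
   apply: leq_trans (leq_b1 _) _; rewrite muln1 addn1.
Qed.

(** A column is visited only if it meets one of the two rows, so the visits are at most as many as
    the nonzeros of both rows. Re-sorting costs at most [K.+1] units per visit, and the update of
    the row lists adds one unit per nonzero. *)
Lemma cost_interchange_rows (L : 'M[R]_n) (k i : 'I_n) (K : nat) :
  (forall j, size (nzcol L j) <= K)%N ->
  (cost (interchange_rows W L k i) <=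
   w_swap W * K.+2 * (size (nzrow L k) + size (nzrow L i)).+1)%N.
Proof.
move=> LK; rewrite /interchange_rows !costE addn0.
set s := [seq j <- enum 'I_n | _].
have ss : (size s <= size (nzrow L k) + size (nzrow L i))%N.
  rewrite !size_filter_ord -big_split; apply: leq_sum => j _ /=.
  by case: (L k j != 0); case: (L i j != 0).
have : (cost (foreach s tt (fun j _ => tick (w_swap W *
    (size [seq l : 'I_n <- nzcol L j | (k <= l <= i)%N]).+1))) <=
    (w_swap W * K.+1) * size s)%N.
  apply: cost_foreach => j _; rewrite cost_tick leq_mul2l ltnS.
  by rewrite (leq_trans _ (LK j)) ?orbT // size_filter_le.
by move: (cost _) (size s) ss => x N ss; nia.
Qed.

Lemma cost_append (L : 'M[R]_n) (k : 'I_n) (l : 'cV[R]_n) :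
  cost (append W L k l) = (w_op W * (size (nzvec l)).+1)%N.
Proof. by rewrite /append !costE addn0. Qed.

Lemma cost_clear (w : 'cV[R]_n) :
  cost (clear W w) = (w_op W * (size (nzvec w)).+1)%N.
Proof. by []. Qed.

Lemma cost_advance (L : 'M[R]_n) (k : 'I_n) :
  (cost (advance W L k) <= w_first W * (size (nzrow L k)).+1)%N.
Proof. by rewrite /advance cost_tick leq_mul2l ltnS size_filter_le orbT. Qed.

End RoutineCosts.

(** * The row potential and its behaviour under the steps *)

Definition row_weight (retry : bool) (k m i : nat) : nat :=
  if (k <= i < m)%N then (if i == k then 2 - retry else 3)%N else 0%N.

Definition row_potential (R : nmodType) (n : nat) (retry : bool) (k m : nat)
    (M : 'M[R]_n) : nat :=
  (\sum_(i < n) row_weight retry k m i * size (nzrow M i))%N.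

(** Only the weight of row [k] changes: it falls from 2 to 1. *)
Lemma row_potential_retry (R : nmodType) (n : nat) (k : 'I_n) (m : nat)
    (M : 'M[R]_n) :
  (k < m)%N ->
  (row_potential true k m M + size (nzrow M k) <= row_potential false k m M)%N.
Proof.
move=> km; rewrite /row_potential (bigD1 k) //= [leqRHS](bigD1 k) //=.
rewrite addnAC leq_add ?leq_sum //.
  by rewrite /row_weight leqnn km eqxx /=; lia.
move=> i ik; apply: leq_mul => //; rewrite /row_weight.
by case: ifP => // _; rewrite (inj_eq val_inj) (negbTE ik).
Qed.

(** Old entries: row [k] leaves the block and frees weight 2, row [k.+1] falls from 3 to 2, and no
    weight grows. New entries: at most [K] from [l] and the unit diagonal, each of weight at most
    3. *)
Lemma row_potential_append (R : realType) (n : nat) (W : weights) (k : 'I_n)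
    (m K : nat) (M : 'M[R]_n) (l : 'cV[R]_n) :
  (k < m)%N -> (size (nzvec l) <= K)%N ->
  (row_potential false k.+1 m (value (append W M k l)) + 2 * size (nzrow M k) <=
   row_potential false k m M + 3 * K.+1)%N.
Proof.
move=> km lK.
have lE : (\sum_(i < n) ((l i 0%R != 0%R) || (i == k)) <= K.+1)%N.
  apply: leq_trans (_ : _ <= size (nzvec l) + 1)%N _; last by rewrite addn1 ltnS.
  rewrite size_filter_ord -[X in (_ <= _ + X)%N](sum_ord_pred1 k) -big_split.
  apply: leq_sum => i _ /=.
  by case: (_ != _); case: (_ == _).
have kE : (2 * size (nzrow M k) =
           \sum_(i < n) (2 * (i == k)) * size (nzrow M i))%N.
  rewrite (bigD1 k) //= eqxx big1 ?addn0 // => i /negbTE ->.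
  by rewrite muln0.
apply: leq_trans (_ : _ <= row_potential false k m M +
  3 * \sum_(i < n) ((l i 0%R != 0%R) || (i == k)))%N _; last first.
  by rewrite leq_add2l leq_mul2l lE.
rewrite kE /row_potential big_distrr -!big_split; apply: leq_sum => i _ /=.
have := size_nzrow_append W M k i l.
move: (size (nzrow (value _) i)) (size (nzrow M i)) => x y xy.
have wi : (row_weight false k.+1 m i + 2 * (i == k) <= row_weight false k m i)%N.
  rewrite /row_weight -[i == k](inj_eq val_inj) /=.
  case: (eqVneq (i : nat) k) => ik; case: (eqVneq (i : nat) k.+1) => ik1;
    by case: ifP; case: ifP; lia.
have w3 : (row_weight false k.+1 m i <= 3)%N.
  by rewrite /row_weight; case: ifP => // _; case: ifP.
apply: leq_trans (leq_add (leq_mul (leqnn _) xy) (leqnn _)) _.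
rewrite mulnDr addnAC -mulnDl leq_add // leq_mul2r; first by rewrite wi orbT.
by rewrite w3 orbT.
Qed.

(** The new block ends at [i]. The old row [i] arrives at position [k] and falls from 3 to 2, while
    the old row [k] leaves the block and loses weight at least 1. So each of the two rows pays for
    one visit of its entries. *)
Lemma row_potential_xrow (R : nmodType) (n : nat) (retry : bool) (k i : 'I_n)
    (m : nat) (M : 'M[R]_n) :
  (k < i < m)%N ->
  (row_potential false k i (xrow k i M) + (size (nzrow M k) + size (nzrow M i)) <=
   row_potential retry k m M)%N.
Proof.
move=> /andP[ki im].
have E (l : 'I_n) : (size (nzrow M l) =
           \sum_(j < n) (j == l) * size (nzrow M j))%N.
  by rewrite (bigD1 l) //= eqxx big1 ?addn0 ?mul1n // => j /negbTE ->.
(* Summed over the old positions [j], the new weight is the one at [tperm k i j], and the claim can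
   be compared row by row. *)
rewrite (E k) (E i) /row_potential (reindex_inj (@perm_inj _ (tperm k i))) /=.
rewrite -!big_split; apply: leq_sum => j _ /=.
rewrite size_nzrow_xrow tpermK -!mulnDl leq_mul2r; apply/orP; right.
have Nik : ((i : nat) == k) = false by rewrite gtn_eqF.
have nik : (i == k) = false by [].
rewrite /row_weight; case: tpermP => [->|->|/eqP jk /eqP ji].
- rewrite ltnn andbF leqnn (ltn_trans ki im) !eqxx [k == i]eq_sym nik.
  by case: (retry).
- by rewrite leqnn ki (ltnW ki) im !eqxx nik Nik.
- rewrite (negbTE jk) (negbTE ji) !addn0.
  rewrite (_ : ((j : nat) == k) = false); last exact: negbTE jk.
  by case: ifP => // /andP[-> ji']; rewrite (ltn_trans ji' im).
Qed.

(** Each decrement of the block size pays for its own test; only the last test remains. *)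
Lemma cost_shrink (R : realType) (P : params R) (W : weights) (n' : nat)
    (d : 'rV[R]_n'.+1) (k m : nat) :
  (cost (shrink P W d k m) + w_op W * value (shrink P W d k m) <= w_op W * m.+1)%N.
Proof.
elim: m => [|m IH]; rewrite [shrink _ _ _ _ _]/= !cost_bind !value_bind cost_tick.
  by rewrite cost_ret value_ret !addn0 muln0 muln1 addn0.
case: ifP => _; last by rewrite cost_ret value_ret addn0 [leqRHS]mulnS.
by rewrite -addnA [leqRHS]mulnS leq_add2l.
Qed.

Definition bounded_fill (R : realType) (n K : nat) (st : state R n) : Prop :=
  (forall j, size (nzcol (st_L st) j) <= K)%N /\
  (forall j, size (nzcol (st_U st)^T j) <= K)%N.

(** [B] is the price of visiting one entry. The last term pays for the tests that shrink the leading
    block. Columns of [U] are treated as rows of the transpose. *)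
Definition potential (R : realType) (n B : nat) (W : weights) (retry : bool)
    (k : nat) (st : state R n) : nat :=
  (B * (row_potential retry k (st_m st) (st_L st) +
        row_potential retry k (st_m st) (st_U st)^T) + w_op W * st_m st)%N.

(** * Amortized cost of one pivoting and of one elimination attempt *)

Section Steps.
Variables (R : realType) (P : params R) (W : weights) (n' : nat).
Let n := n'.+1.
Variables (A : 'M[R]_n) (sym : bool) (c : nat).
Hypothesis Ac : forall j, (size (nzcol A j) <= c)%N.
Hypothesis Ar : forall i, (size (nzrow A i) <= c)%N.

(** A common bound for both factors: the entries kept by thresholding, plus the unit diagonal. *)
Let K := ((alpha_L P + alpha_U P) * c).+1.

Let Bcrout := ((w_acc W + w_op W) * c + w_op W * (1 + K + K))%N.
(** Per unit of [S] in [elimination_bounds], this covers the fill of either Crout vector and one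
    more. The coefficient 4 is twice that of [crout_bounds], since copying in the symmetric case may
    add the fill of one vector to the other. *)
Let Bnz := (4 * c + 4 * K).+1.
Let Belim := (2 * Bcrout + w_op W * (10 * Bnz) + w_thr W * (2 * Bnz)
  + 2 * (w_sort W * (K * up_log 2 K).+1) + 4 * w_first W)%N.
Let Bswap := (w_swap W * K.+2)%N.
Let B := (2 * Bswap + Belim)%N.

(** The interchanges are paid by [row_potential_xrow], applied to [L] and to the transpose of [U].
    The summand [2 * w_op W] covers the last test of [shrink] and the final bookkeeping. If no
    candidate is left, only the tests have to be paid. *)
Lemma pivoting_bounds (st : state R n) (k : nat) (retry : bool) :
  bounded_fill K st -> (k < st_m st <= n)%N ->
  let st1 := pivoting P W st k in
  if value st1 is Some st1' then
    bounded_fill K st1' /\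
    (cost st1 + potential B W false k st1' <=
     2 * w_op W + B + potential B W retry k st)%N
  else (cost st1 <= w_op W + potential B W retry k st)%N.
Proof.
case: st => p q m d L U yL yU piv; rewrite /bounded_fill /potential.
cbn [st_L st_U st_m]; move=> [LK UK] /andP[km mn].
rewrite /pivoting value_bind cost_bind.
have shm := shrink_le P W d k m; have := cost_shrink P W d k m.
move: (cost (shrink _ _ _ _ _)) (value (shrink _ _ _ _ _)) shm => s m1 m1m sh.
case: ifP => [_|/negbT].
  by rewrite value_ret cost_ret; move: sh; rewrite mulnS; lia.
rewrite -ltnNge => km1; rewrite !value_bind !costE value_ret; cbn [st_L st_U st_m].
have kkE : (inord k : 'I_n) = k :> nat by rewrite inordK //; lia.
have mmE : (inord m1.-1 : 'I_n) = m1.-1 :> nat by rewrite inordK //; lia.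
rewrite !value_ret trmxK; split.
  by split=> j; rewrite size_nzcol_xrow.
set kk : 'I_n := inord k in kkE *; set mm : 'I_n := inord m1.-1 in mmE *.
have := cost_interchange_rows W kk mm LK.
have := cost_interchange_rows W kk mm UK.
have kmm : (kk < mm < m)%N by rewrite kkE mmE; lia.
have := row_potential_xrow retry L kmm.
have := row_potential_xrow retry U^T kmm.
rewrite -/Bswap /interchange_rows kkE mmE.
move: (size _ + size _)%N (size _ + size _)%N => xU xL.
move: (row_potential _ _ _ _) (row_potential _ _ _ _) => fU fU'.
move: (row_potential _ _ _ _) (row_potential _ _ _ _) => fL fL'.
rewrite !costE; move: (cost _) (cost _) => cU cL.
(* The [.+1] in the costs of the two interchanges is not paid by the potential; it is charged to the
   constant [B]. *)
have : (Bswap.*2 <= B)%N by rewrite /B; lia.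
have : (w_op W * m1.-1 <= w_op W * m1)%N by rewrite leq_mul2l leq_pred orbT.
rewrite mulnS in sh.
by move: B Bswap => B0 B1; nia.
Qed.

(** Either outcome frees enough potential to pay for the visited row of [L] and column of [U]. A
    success also stores at most [K.+1] entries per factor, of weight at most 3, whence [6 * K.+1]. A
    failure stores nothing and is paid by the fall of the weight at position [k] from 2 to 1. *)
Lemma elimination_bounds (st : state R n) (k : nat) :
  bounded_fill K st -> (k < st_m st <= n)%N ->
  let st1 := elimination P W A sym st k in
  if value st1 is Some st2 then
    bounded_fill K st2 /\
    (cost st1 + potential B W false k.+1 st2 <=
     B * (1 + 6 * K.+1) + potential B W false k st)%N
  else (cost st1 + potential B W true k st <= B + potential B W false k st)%N.
Proof.
case: st => p q m d L U yL yU piv; rewrite /bounded_fill /potential.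
cbn [st_L st_U st_m]; move=> [LK UK] /andP[km mn].
rewrite /elimination; set kk : 'I_n := inord k.
have kkE : kk = k :> nat by rewrite inordK //; lia.
set l := crout _ A _ _ _ _ _ _ _; set u0 := crout _ A^T _ _ _ _ _ _ _.
set eL := estimate _ L _ _; set eU := estimate _ U^T _ _.
have [lN lC] := @crout_bounds R n W A p q L U d kk
  (fun i => (k < i)%N) c K (Ac _) LK.
have ATp : (size (nzcol A^T (p kk)) <= c)%N by rewrite nzcol_tr.
have [uN uC] := @crout_bounds R n W A^T q p U^T L^T d kk
  (fun i => (k < i)%N && ~~ (sym && (i < m)%N)) c K ATp UK.
rewrite -/l in lN lC; rewrite -/u0 nzcol_tr in uN uC.
have eLC : (cost eL <= w_op W * _)%N := cost_estimate W L yL kk.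
have eUC : (cost eU <= w_op W * _)%N := cost_estimate W U^T yU kk.
rewrite -[nzrow U^T kk]nzcol_tr trmxK in eUC.
clearbody l u0 eL eU; rewrite 3!value_bind 3!cost_bind.
set u := if sym then _ else _.
have [u'N u'C] : (size (nzvec (value u)) <=
    size (nzvec (value u0)) + size (nzvec (value l)))%N /\
    (cost u <= w_op W * size (nzvec (value l)))%N.
  rewrite /u; case: ifP => _; last by rewrite cost_ret value_ret leq_addr.
  split; last by apply: cost_foreach => i y; rewrite !costE addn0.
  rewrite -[X in (_ <= _ + X)%N]mul1n.
  apply: (value_foreach_le (f := fun v : 'cV[R]_n => size (nzvec v))) => i y.
  by rewrite value_bind value_ret; case: ifP => _;
     rewrite ?size_nzvec_setv // leq_addr.
have rUE : nzrow U^T kk = nzcol U kk by rewrite -nzcol_tr trmxK.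
clearbody u; rewrite 3!value_bind 3!cost_bind cost_tick.
set a := size (nzrow L kk) in uN uC eLC *.
set b := size (nzcol U kk) in lN lC eUC *.
(* All costs of the attempt are bounded by multiples of [S]: the visited entries, and 1 for the
   constant parts. *)
pose S := (a + b).+1.
have lS : ((size (nzvec (value l))).+1 <= Bnz * S)%N.
  by apply: leq_ltn_trans lN _; rewrite /Bnz /S; lia.
have uS : ((size (nzvec (value u))).+1 <= Bnz * S)%N.
  by apply: leq_ltn_trans u'N _; move: lN uN; rewrite /Bnz /S; lia.
have opS : (w_op W * S <= w_op W * (Bnz * S))%N.
  by rewrite leq_mul2l leq_pmull ?orbT.
have opl : (w_op W * (size (nzvec (value l))).+1 <= w_op W * (Bnz * S))%N.
  by rewrite leq_mul2l lS orbT.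
have opu : (w_op W * (size (nzvec (value u))).+1 <= w_op W * (Bnz * S))%N.
  by rewrite leq_mul2l uS orbT.
have lCS : (cost l <= Bcrout * S)%N.
  apply: leq_trans lC _; rewrite /Bcrout [leqRHS]mulnDl leq_add ?leq_pmulr //.
  by rewrite leq_mul // /S; lia.
have uCS : (cost u0 <= Bcrout * S)%N.
  apply: leq_trans uC _; rewrite /Bcrout [leqRHS]mulnDl leq_add ?leq_pmulr //.
  by rewrite leq_mul // /S; lia.
have eLCS : (cost eL <= w_op W * S)%N.
  by apply: leq_trans eLC _; rewrite leq_mul2l ltnS leq_addr orbT.
have eUCS : (cost eU <= w_op W * S)%N.
  by apply: leq_trans eUC _; rewrite leq_mul2l ltnS leq_addl orbT.
have op1 : (w_op W <= w_op W * S)%N by rewrite leq_pmulr.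
have kkm : (kk < m)%N by rewrite kkE.
have BelimB : (Belim * S <= B * S)%N by rewrite leq_mul2r leq_addl orbT.
case: ifP => _.
  rewrite !value_bind !costE value_ret.
  have := row_potential_retry L kkm; have := row_potential_retry U^T kkm.
  rewrite rUE -/a -/b kkE.
  move: (row_potential _ _ _ _) (row_potential _ _ _ _) => fU fU' fUE.
  move: (row_potential _ _ _ _) (row_potential _ _ _ _) => fL fL' fLE.
  (* The potential falls by at least [a + b], so a single extra [B] suffices for [S]. *)
  have BE : (B * (fL' + fU' + S) <= B * (fL + fU).+1)%N.
    by rewrite leq_mul2l; apply/orP; right; move: fUE fLE; rewrite /S; lia.
  rewrite !addnA leq_add2r addnC [leqRHS]addnC -mulnSr.
  apply: leq_trans BE; rewrite [leqRHS]mulnDr leq_add2l; apply: leq_trans BelimB.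
  rewrite /Belim; move: (cost l) (cost u0) (cost u) (cost eL) (cost eU) u'C eLCS
    eUCS lCS uCS opl opu opS op1 => x1 x2 x3 x4 x5.
  move: (size (nzvec (value l))) (size (nzvec (value u))) => Nl Nu.
  clearbody S Bcrout Bnz; lia.
set d' := foreach _ d _.
have dC : (cost d' <= w_op W * size (nzvec (value l)))%N.
  by apply: cost_foreach => i y; rewrite !costE addn0.
clearbody d'.
set lk := threshold _ _ _ _ (value l); set uk := threshold _ _ _ _ (value u).
have tK (t : nat) : (t <= (alpha_L P + alpha_U P) * c)%N ->
    (w_sort W * (t * up_log 2 t).+1 <= w_sort W * (K * up_log 2 K).+1)%N.
  by move=> /leqW tK; rewrite leq_mul2l ltnS leq_mul ?orbT // leq_up_log.
have [lkN lkC] : (size (nzvec (value lk)) <= (alpha_L P + alpha_U P) * c)%N /\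
    (cost lk <= w_thr W * (size (nzvec (value l))).+1
                + w_sort W * (K * up_log 2 K).+1)%N.
  have le : (alpha_L P * nnz (col (q kk) A) <= (alpha_L P + alpha_U P) * c)%N.
    by rewrite leq_mul ?leq_addr // nnz_col.
  have [N C] := threshold_bounds W (tau_L P) `|value eL|
    (alpha_L P * nnz (col (q kk) A)) (value l).
  split; first exact: leq_trans N le.
  by apply: leq_trans C _; rewrite leq_add2l tK.
have [ukN ukC] : (size (nzvec (value uk)) <= (alpha_L P + alpha_U P) * c)%N /\
    (cost uk <= w_thr W * (size (nzvec (value u))).+1
                + w_sort W * (K * up_log 2 K).+1)%N.
  have le : (alpha_U P * nnz (row (p kk) A) <= (alpha_L P + alpha_U P) * c)%N.
    by rewrite leq_mul ?leq_addl // nnz_row.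
  have [N C] := threshold_bounds W (tau_U P) `|value eU|
    (alpha_U P * nnz (row (p kk) A)) (value u).
  split; first exact: leq_trans N le.
  by apply: leq_trans C _; rewrite leq_add2l tK.
clearbody lk uk; rewrite 5!value_bind 5!cost_bind !cost_clear.
set L' := append _ L _ _; set Ut' := append _ U^T _ _.
have L'K j : (size (nzcol (value L') j) <= K)%N.
  apply: leq_trans (size_nzcol_append W L kk j (value lk)) _.
  by case: ifP.
have Ut'K j : (size (nzcol (value Ut') j) <= K)%N.
  apply: leq_trans (size_nzcol_append W U^T kk j (value uk)) _.
  by case: ifP.
have L'r : (size (nzrow (value L') kk) <= a.+1)%N.
  apply: leq_trans (size_nzrow_append W L kk kk (value lk)) _.
  by rewrite eqxx orbT addn1.
have Ut'r : (size (nzrow (value Ut') kk) <= b.+1)%N.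
  apply: leq_trans (size_nzrow_append W U^T kk kk (value uk)) _.
  by rewrite eqxx orbT addn1 rUE.
have := row_potential_append W L kkm (leqW lkN).
have := row_potential_append W U^T kkm (leqW ukN).
have L'C := cost_append W L kk (value lk).
have Ut'C := cost_append W U^T kk (value uk).
rewrite -/L' -/Ut' rUE -/a -/b kkE in L'C Ut'C * => fUE fLE.
clearbody L' Ut'; rewrite 4!value_bind 4!cost_bind.
set cL := cost (advance _ (value L') _); set cU := cost (advance _ (value Ut') _).
have cLC : (cL <= w_first W * a.+2)%N.
  by apply: leq_trans (cost_advance _ _ _) _; rewrite leq_mul2l ltnS L'r orbT.
have cUC : (cU <= w_first W * b.+2)%N.
  by apply: leq_trans (cost_advance _ _ _) _; rewrite leq_mul2l ltnS Ut'r orbT.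
clearbody cL cU; rewrite !value_bind !costE value_ret; cbn [st_L st_U st_m].
rewrite trmxK; split; first by [].
move: fUE fLE.
move: (row_potential _ _ _ (value Ut')) (row_potential _ _ _ U^T) => fU' fU fUE.
move: (row_potential _ _ _ (value L')) (row_potential _ _ _ L) => fL' fL fLE.
have BE : (B * (fL' + fU' + S) <= B * (fL + fU + (1 + 6 * K.+1)))%N.
  by rewrite leq_mul2l; apply/orP; right; move: fUE fLE; rewrite /S; lia.
rewrite !addnA leq_add2r addnC -addnA [leqRHS]addnC -[leqRHS]mulnDr.
apply: leq_trans BE; rewrite [leqRHS]mulnDr leq_add2l; apply: leq_trans BelimB.
have thrl : (w_thr W * (size (nzvec (value l))).+1 <= w_thr W * (Bnz * S))%N.
  by rewrite leq_mul2l lS orbT.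
have thru : (w_thr W * (size (nzvec (value u))).+1 <= w_thr W * (Bnz * S))%N.
  by rewrite leq_mul2l uS orbT.
have sortS : (w_sort W * (K * up_log 2 K).+1 <=
              w_sort W * (K * up_log 2 K).+1 * S)%N by rewrite leq_pmulr.
have opK : (w_op W * K.+1 <= w_op W * (Bnz * S))%N.
  rewrite leq_mul2l; apply/orP; right; apply: leq_trans (leq_pmulr _ _) => //.
  by rewrite /Bnz; lia.
have oplk : (w_op W * (size (nzvec (value lk))).+1 <= w_op W * K.+1)%N.
  by rewrite leq_mul2l ltnS (leqW lkN) orbT.
have opuk : (w_op W * (size (nzvec (value uk))).+1 <= w_op W * K.+1)%N.
  by rewrite leq_mul2l ltnS (leqW ukN) orbT.
have firstS : (w_first W * (a.+2 + b.+2) <= w_first W * (4 * S))%N.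
  by rewrite leq_mul2l /S; apply/orP; right; lia.
(* Every cost is rounded up to multiples of these five products, so that the final comparison
   becomes linear in them. *)
have -> : (Belim * S = 2 * (Bcrout * S) + 10 * (w_op W * (Bnz * S))
    + 2 * (w_thr W * (Bnz * S)) + 2 * (w_sort W * (K * up_log 2 K).+1 * S)
    + w_first W * (4 * S))%N.
  by rewrite /Belim; move: (w_sort W * _)%N => sortK; clearbody S Bcrout Bnz; lia.
have opN : (w_op W * size (nzvec (value l)) <= w_op W * (Bnz * S))%N.
  by apply: leq_trans opl; rewrite leq_mul2l leqnSn orbT.
have {}u'C := leq_trans u'C opN; have {}dC := leq_trans dC opN.
have {}eLCS := leq_trans eLCS opS; have {}eUCS := leq_trans eUCS opS.
have {op1}opS := leq_trans op1 opS.
have {}lkC := leq_trans lkC (leq_add thrl sortS).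
have {}ukC := leq_trans ukC (leq_add thru sortS).
have {oplk}L'C := leq_trans (eq_leq L'C) (leq_trans oplk opK).
have {opuk}Ut'C := leq_trans (eq_leq Ut'C) (leq_trans opuk opK).
have {cLC cUC}cLU := leq_add cLC cUC.
rewrite -mulnDr in cLU; have {firstS}cLU := leq_trans cLU firstS.
rewrite addn0 -(addnA _ cL cU).
apply: leq_trans (leq_add (leq_add (leq_add (leq_add (leq_add (leq_add (leq_add
  (leq_add (leq_add (leq_add (leq_add (leq_add (leq_add (leq_add lCS uCS) u'C)
  eLCS) eUCS) opS) dC) lkC) ukC) opl) opu) L'C) Ut'C) cLU) opS) _.
move: (Bcrout * S)%N (w_op W * (Bnz * S))%N (w_thr W * (Bnz * S))%N
  (w_sort W * _ * S)%N (w_first W * (4 * S))%N.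
by clear; lia.
Qed.

(** * Summation over the loop and the whole run *)

Let Cstep := (3 * w_op W + B + B * (1 + 6 * K.+1))%N.

(** The amortized bounds telescope. One unit of fuel is one round, and [Cstep] collects what the
    potential does not pay: the loop test, one pivoting and one elimination attempt. *)
Lemma iludp_loop_bound (fuel k : nat) (retry : bool) (st : state R n) :
  bounded_fill K st -> (st_m st <= n)%N ->
  (cost (iludp_loop P W A sym fuel retry k st) <=
   Cstep * fuel + potential B W retry k st)%N.
Proof.
elim: fuel k retry st => [|fuel IH] k retry st stK mn; first by [].
rewrite [iludp_loop _ _ _ _ _ _ _ _]/= cost_bind cost_tick mulnS.
case: (leqP (st_m st) k) => km; first by rewrite cost_ret /Cstep; lia.
rewrite cost_bind; set r := if _ || _ then _ else _.
have : if value r is Some st1 then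
    bounded_fill K st1 /\ (k < st_m st1 <= n)%N /\
    (cost r + potential B W false k st1 <=
     2 * w_op W + B + potential B W retry k st)%N
  else (cost r <= w_op W + potential B W retry k st)%N.
  rewrite {}/r; case: (boolP (retry || _)) => [_|]; last first.
    (* Pivoting is skipped only when [retry] is false, so the state and its potential stay the
       same. *)
    rewrite negb_or => /andP[/negbTE-> _]; rewrite value_ret cost_ret.
    by rewrite km mn leq_addl.
  have kmn : (k < st_m st <= n)%N by rewrite km.
  have := pivoting_bounds retry stK kmn; cbv zeta.
  case E: (value (pivoting _ _ _ _)) => [st1|//] [st1K st1C]; split=> //; split=> //.
  by have /andP[-> lt] := pivoting_m E; rewrite (leq_trans (ltnW lt)).
case: (value r) => [st1 [st1K [km1 st1C]]|rC]; last by rewrite cost_ret /Cstep; lia.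
rewrite cost_bind.
have := elimination_bounds st1K km1; cbv zeta.
set e := elimination _ _ _ _ _ _.
case E: (value e) => [st2|] => [[st2K st2C]|st2C].
  have m2 : (st_m st2 <= n)%N.
    by rewrite (elimination_m E); case/andP: km1.
  apply: leq_trans (_ : w_op W + (cost r + (cost e + (Cstep * fuel +
    potential B W false k.+1 st2))) <= _)%N; first by rewrite !leq_add2l; exact: IH.
  move: st1C st2C; clearbody r; move: (Cstep * fuel)%N; rewrite /Cstep.
  move: (potential _ _ _ _ st1) (potential _ _ _ _ st2) (potential _ _ _ _ st).
  by move=> p1 p2 p0 F; clearbody e B; lia.
have m1 : (st_m st1 <= n)%N by case/andP: km1.
apply: leq_trans (_ : w_op W + (cost r + (cost e + (Cstep * fuel +
  potential B W true k st1))) <= _)%N; first by rewrite !leq_add2l; exact: IH.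
move: st1C st2C; clearbody r; move: (Cstep * fuel)%N; rewrite /Cstep.
move: (potential _ _ true _ st1) (potential _ _ false _ st1) (potential _ _ _ _ st).
by move=> p1 p2 p0 F; clearbody e B; lia.
Qed.

Let Cinit := (w_op W * (1 + (alpha_L P + alpha_U P) * c) + w_op W + w_acc W * c)%N.

Lemma initialize_cost (p q : 'S_n) (m : nat) :
  (cost (initialize P W A p q m) <= Cinit * n)%N.
Proof.
rewrite /initialize !costE addn0.
have nnzA : (nnz A <= c * n)%N.
  rewrite nnzE mulnC -[X in (_ <= X * _)%N]card_ord -sum_nat_const.
  by apply: leq_sum => i _; rewrite -size_filter_ord Ar.
rewrite /Cinit -[X in (_ <= X * _)%N]addnA [leqRHS]mulnDl leq_add //.
  rewrite -mulnA leq_mul2l; apply/orP; right.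
  by rewrite -addnA -mulnDl [leqRHS]mulnDl mul1n leq_add2l -mulnA leq_mul.
apply: leq_trans (cost_foreach (a := w_op W + w_acc W * c) _ _ _) _.
  move=> i d; rewrite !costE leq_add2l.
  apply: leq_trans (cost_foreach (a := w_acc W) _ _ _) _.
    by move=> j y; rewrite !costE addn0.
  by rewrite leq_mul2l Ar orbT.
by rewrite size_enum_ord.
Qed.

(** [L] and [U] start empty, so the initial potential is only [w_op W * m]. *)
Lemma iludp_factor_cost (p q : 'S_n) (m : nat) :
  (m <= n)%N ->
  (cost (iludp_factor P W A sym p q m) <= (Cinit + (Cstep * 3 + w_op W)) * n)%N.
Proof.
move=> mn; rewrite /iludp_factor cost_bind.
set st := value _.
have [stK stm stpot] : [/\ bounded_fill K st, st_m st = m &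
    potential B W false 0 st = (w_op W * m)%N].
  rewrite /st /initialize !value_bind value_ret /potential.
  have Z (j : 'I_n) : size (nzcol (0 : 'M[R]_n) j) = 0%N.
    by rewrite size_filter_ord big1 // => i _; rewrite mxE eqxx.
  have Z' : row_potential false 0 m (0 : 'M[R]_n) = 0%N.
    by rewrite /row_potential big1 // => i _; rewrite -nzcol_tr trmx0 Z muln0.
  split=> //; cbn [st_L st_U st_m]; last by rewrite trmx0 Z' muln0.
  by split=> j; cbn [st_L st_U]; rewrite ?trmx0 Z.
rewrite mulnDl leq_add ?initialize_cost //.
have := iludp_loop_bound m.+2 0 false stK; rewrite stm stpot => /(_ mn)/leq_trans.
apply; rewrite [leqRHS]mulnDl -mulnA leq_add // leq_mul2l ?mn ?orbT //.
(* The fuel [m.+2] is at most [3 * n], as [m <= n] and [n] is positive. *)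
by apply/orP; right; rewrite /n in mn *; lia.
Qed.

End Steps.

Theorem proposition2 (R : realType) (P : params R) (W : weights) (c b : nat)
    (hP : valid_params P) :
  exists C : nat,
    forall (n' : nat) (A0 : 'M[R]_n'.+1) (r s : 'rV[R]_n'.+1)
           (p q : 'S_n'.+1) (m : nat) (sym : bool),
      let n := n'.+1 in
      let A := diag_mx r *m A0 *m diag_mx s in
      let run := iludp_factor P W A sym p q m in
      (forall i : 'I_n, (nnz (row i A0) <= c)%N) ->
      (forall j : 'I_n, (nnz (col j A0) <= c)%N) ->
      (forall i : 'I_n, r 0 i != 0) ->
      (forall j : 'I_n, s 0 j != 0) ->
      (m <= n)%N ->
      (sym -> forall i j : 'I_n, (i < m)%N -> (j < m)%N ->
         A (p i) (q j) = A (p j) (q i)) ->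
      (forall k : 'I_n, (count_mem k (st_piv (value run)) <= b)%N) ->
      (cost run <= C * n)%N.
Proof.
(* The constant is left open and read off from [iludp_factor_cost]; it depends on [P], [W] and [c]
   only. *)
eexists => n' A0 r s p q m sym n A run rowA colA r0 s0 mn _ _.
(* Scaling by nonzero factors preserves the sparsity pattern, so the bounds on [A0] carry over to
   [A]. *)
have AE i j : (A i j != 0) = (A0 i j != 0).
  rewrite /A mul_mx_diag mxE mul_diag_mx mxE !mulf_eq0 (negbTE (r0 _)).
  by rewrite (negbTE (s0 _)) orbF.
apply: (@iludp_factor_cost R P W n' A sym c) => // i.
- rewrite (leq_trans _ (colA i)) // nnz_col !size_filter_ord.
  by apply: leq_sum => j _; rewrite AE.
- rewrite (leq_trans _ (rowA i)) // nnz_row !size_filter_ord.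
  by apply: leq_sum => j _; rewrite AE.
Qed.
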